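(* Let $n\in\mathbb{N}$, $\beta \in (0,n)$ and $p \in [1,+\infty)$. (i) If $p>1$, then there exists a constant $C=C(\beta,n,p)>0$ such that for every $f \in L^p(\mathcal{H}^{\beta}_\infty)$ $$\int_{\mathbb{R}^n} (\mathcal{M}_{\mathcal{H}^\beta_\infty} f)^p \, d \mathcal{H}^\beta_\infty \leq C \int_{\mathbb{R}^n} |f|^p \, d \mathcal{H}^\beta_\infty .$$ (ii) If $p=1$, then there exists a constant $C=C(\beta,n)>0$ such that for every $f\in L^1(\mathcal{H}^\beta_\infty)$ and every $t>0$ $$\mathcal{H}^\beta_\infty \left( \{ x\in \mathbb{R}^n: \mathcal{M}_{\mathcal{H}^\beta_\infty} f(x) >t \} \right)\leq \frac{C}{t} \int_{\mathbb{R}^n} |f| \, d \mathcal{H}^\beta_\infty .$$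
   Context: For $\beta\in(0,n]$ the Hausdorff content of $E\subseteq\mathbb{R}^n$ is $\mathcal{H}^{\beta}_{\infty}(E):= \inf \{\sum_{i=1}^\infty \omega_{\beta} r_i^\beta : E \subset \bigcup_{i=1}^\infty B(x_i,r_i) \}$, where $\omega_\beta:= \pi^{\beta/2}/ \Gamma(\beta/2+1)$ and $B(x,r)$ is the open ball with center $x$ and radius $r$. For an $\mathcal{H}^\beta_\infty$-almost everywhere defined function $g$ with values in $[0,\infty]$, the Choquet integral is $\int_{\mathbb{R}^n} g \, d \mathcal{H}^{\beta}_\infty := \int_0^\infty \mathcal{H}^{\beta}_\infty(\{ g>t\})\,dt$, and $\int_{A} g\,d\mathcal{H}^\beta_\infty:=\int_{\mathbb{R}^n} g\chi_A\,d\mathcal{H}^\beta_\infty$ for $A\subseteq\mathbb{R}^n$. A function $f$ (real-valued, defined $\mathcal{H}^\beta_\infty$-almost everywhere) is $\mathcal{H}^\beta_\infty$-quasicontinuous if for every $\varepsilon>0$ there is an open set $O$ with $\mathcal{H}^\beta_\infty(O)<\varepsilon$ such that $f$ restricted to $\mathbb{R}^n\setminus O$ is continuous. For $p\in(0,\infty)$, $L^p(\mathcal{H}^{\beta}_{\infty})$ is the set of $\mathcal{H}^{\beta}_{\infty}$-quasicontinuous functions $f$ with $\|f\|_{L^p(\mathcal{H}^{\beta}_{\infty})}:=(\int_{\mathbb{R}^n} |f|^p \, d \mathcal{H}^{\beta}_\infty)^{1/p}<\infty$. The centered Hausdorff content maximal function is $$\mathcal{M}_{\mathcal{H}^\beta_\infty}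 f(x) := \sup_{r>0} \frac{1}{\omega_\beta r^\beta} \int_{B(x,r)} |f| \,d\mathcal{H}^{\beta}_{\infty}.$$ *)

(* Defs.v *)
From HB Require Import structures.
From mathcomp Require Import all_boot all_order all_algebra.
From mathcomp Require Import all_classical all_reals all_analysis.
Import Order.TTheory GRing.Theory Num.Theory.
Import numFieldNormedType.Exports.

Set Implicit Arguments.
Unset Strict Implicit.
Unset Printing Implicit Defensive.

Local Open Scope classical_set_scope.
Local Open Scope ring_scope.

(* The norm that the library puts on 'rV[R]_n is the sup norm, so Euclidean
   balls are defined by hand; both norms induce the library's topology. *)
Definition eball (R : realType) (n : nat) (x : 'rV[R]_n) (r : R)
    : set 'rV[R]_n :=
  [set y | Num.sqrt (\sum_(i < n) (y ord0 i - x ord0 i) ^+ 2) < r].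

Definition Gamma (R : realType) (s : R) : R :=
  \int[lebesgue_measure]_(x in `]0, +oo[) (x `^ (s - 1) * expR (- x)).

Definition omega (R : realType) (beta : R) : R :=
  pi `^ (beta / 2) / Gamma (beta / 2 + 1).

Definition hcontent (R : realType) (n : nat) (beta : R) (E : set 'rV[R]_n)
    : \bar R :=
  ereal_inf [set s | exists (x : nat -> 'rV[R]_n) (r : nat -> R),
    [/\ forall i, 0 < r i,
        E `<=` \bigcup_i eball (x i) (r i) &
        s = (\sum_(0 <= i <oo) (omega beta * r i `^ beta)%:E)%E]].

(* A function defined only almost everywhere is given by a set D (its domain of
   definition) and a total function whose values outside D are never used. *)

Definition choquet (R : realType) (n : nat) (beta : R) (D : set 'rV[R]_n)
    (g : 'rV[R]_n -> \bar R) : \bar R :=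
  (\int[lebesgue_measure]_(t in `]0%R, +oo[)
     hcontent beta [set x | D x /\ t%:E < g x])%E.

Definition choquet_on (R : realType) (n : nat) (beta : R) (D : set 'rV[R]_n)
    (A : set 'rV[R]_n) (g : 'rV[R]_n -> \bar R) : \bar R :=
  choquet beta D (g \_ A).

Definition ae_domain (R : realType) (n : nat) (beta : R) (D : set 'rV[R]_n)
    : Prop :=
  hcontent beta (~` D) = 0%E.

Definition quasicontinuous (R : realType) (n : nat) (beta : R)
    (D : set 'rV[R]_n) (f : 'rV[R]_n -> R) : Prop :=
  forall eps : R, 0 < eps ->
    exists O : set 'rV[R]_n,
      [/\ open O, (hcontent beta O < eps%:E)%E &
          {within D `\` O, continuous f}].

Definition Lp_norm (R : realType) (n : nat) (beta p : R)
    (D : set 'rV[R]_n) (f : 'rV[R]_n -> R) : \bar R :=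
  (choquet beta D (fun x => (`|f x| `^ p)%:E) `^ p^-1)%E.

Definition in_Lp (R : realType) (n : nat) (beta p : R)
    (D : set 'rV[R]_n) (f : 'rV[R]_n -> R) : Prop :=
  [/\ ae_domain beta D, quasicontinuous beta D f &
      (Lp_norm beta p D f < +oo)%E].

Definition maximal (R : realType) (n : nat) (beta : R)
    (D : set 'rV[R]_n) (f : 'rV[R]_n -> R) (x : 'rV[R]_n) : \bar R :=
  ereal_sup [set ((omega beta * r `^ beta)^-1%:E *
                  choquet_on beta D (eball x r) (fun y => `|f y|%:E))%E
            | r in [set r : R | 0 < r]].

(* Main.v *)
(* No measurability or continuity of f enters: everything rests on Choquet
   integrals of f being integrals in s of the contents of the layers
   {|f| > s}.  Write nu_a(B) for the integral over s > a of the content of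
   {|f| > s} `&` B.

   The content is not additive on disjoint sets, but it is, up to a constant,
   superadditive on a disjoint family of dyadic cubes satisfying the packing
   condition  sum_{Q in S, Q <= P} l(Q)^beta <= 2 l(P)^beta  for all dyadic P
   (check it on each ball of a cover); integrating in s, nu_a inherits this.
   The points x for which some ball B(x, r) has nu_a(B(x, r)) > t omega r^beta
   lie in dilates of dyadic cubes Q with nu_a(Q) >= c t l(Q)^beta.  Take a
   maximal packing subfamily S of the maximal such cubes (Melnikov,
   Orobitg-Verdera): any maximal cube lies in some dyadic P with
   l(P)^beta <= sum_{Q in S, Q <= P} l(Q)^beta, and the maximal such P have
   sum l(P)^beta <= sum_S l(Q)^beta <= (C / t) nu_a(R^n).  This bounds the
   content of the set of such x by (C' / t) nu_a(R^n).

   With a = 0 this is the weak type bound.  With a = t / 2, splitting the layers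
   at height t / 2 gives  H(Mf > t) <= (C / t) nu_{t/2}(R^n)
   <= C sum_k 2^k H(|f| > 2^(k-1) t).  Put t = u^(1/p) and integrate in u: the
   k-th term scales by 2^(k-p(k-1)), and the geometric series converges for
   p > 1. *)
Require Import Defs.
From HB Require Import structures.
From mathcomp Require Import all_boot all_order all_algebra.
From mathcomp Require Import all_classical all_reals all_analysis.
From mathcomp Require Import measurable_realfun zify ring lra.
Import Order.TTheory GRing.Theory Num.Theory.
Import numFieldNormedType.Exports.

Set Implicit Arguments.
Unset Strict Implicit.
Unset Printing Implicit Defensive.

Local Open Scope classical_set_scope.
Local Open Scope ring_scope.

(** * Hausdorff content as an outer measure *)

Lemma omega_ge0 (R : realType) (beta : R) : 0 <= omega beta.
Proof.
rewrite /omega divr_ge0 ?powR_ge0// /Gamma Rintegral_ge0// => x _.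
by rewrite mulr_ge0 ?powR_ge0 ?expR_ge0.
Qed.

Section content.
Context (R : realType) (n : nat) (beta : R).
Hypothesis beta_gt0 : 0 < beta.
Local Open Scope ereal_scope.
Implicit Types (E : set 'rV[R]_n).
Local Notation H := (@hcontent R n beta).

Lemma ball_term_ge0 (r : R) : 0 <= (omega beta * r `^ beta)%:E.
Proof. by rewrite lee_fin mulr_ge0 ?powR_ge0 ?omega_ge0. Qed.

Lemma hcontent_ge0 E : 0 <= H E.
Proof.
apply: le_ereal_inf_tmp => _ [x [r [_ _ ->]]].
by apply: nneseries_ge0 => i _ _; exact: ball_term_ge0.
Qed.

Lemma le_hcontent : {homo H : A B / A `<=` B >-> A <= B}.
Proof.
move=> A B AB; apply: ereal_inf_le_tmp => _ [x [r [r0 Bxr ->]]].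
by exists x, r; split => //; exact: subset_trans Bxr.
Qed.

Lemma eball_sub (x : 'rV[R]_n) (r s : R) : (r <= s)%R -> eball x r `<=` eball x s.
Proof. by move=> rs y /= /lt_le_trans; apply. Qed.

(* Radii are allowed to vanish here, unlike in the definition of [hcontent]:
   an empty ball is replaced by one of negligible size. *)
Lemma hcontent_le E (x : nat -> 'rV[R]_n) (r : nat -> R) :
  (forall i, 0 <= r i)%R -> E `<=` \bigcup_i eball (x i) (r i) ->
  H E <= \sum_(i <oo) (omega beta * r i `^ beta)%:E.
Proof.
move=> r0 Exr; apply/lee_addgt0Pr => e e0.
apply: le_trans (epsilon_trick _ _ (ltW e0)); last first.
  by move=> i; exact: ball_term_ge0.
pose d i := (e / (2 ^ i.+1)%:R)%R.
have d0 i : (0 < d i)%R by rewrite divr_gt0// ltr0n expn_gt0.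
(* This radius costs [omega beta / (omega beta + 1)] times [d i], hence at most [d i]; the added 1
   keeps it positive even if [omega beta] is 0. *)
pose s i := if r i == 0%R then ((d i / (omega beta + 1)) `^ beta^-1)%R else r i.
have w1 : (0 < omega beta + 1)%R by rewrite ltr_wpDl ?omega_ge0.
have s0 i : (0 < s i)%R.
  rewrite /s; case: ifPn => [_|ri]; first by rewrite powR_gt0// divr_gt0.
  by rewrite lt_def ri r0.
apply: (@le_trans _ _ (\sum_(i <oo) (omega beta * s i `^ beta)%:E)).
  apply: ereal_inf_lbound; exists x, s; split=> //.
  apply: subset_trans Exr _ => y [i _ yi]; exists i => //.
  apply: eball_sub yi; rewrite /s; case: eqP => [->|//]; exact: powR_ge0.
apply: lee_nneseries => i *; first exact: ball_term_ge0.
rewrite -EFinD lee_fin /s; case: eqP => [->|_]; last by rewrite lerDl ltW// d0.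
rewrite -powRrM mulVf ?gt_eqF// powRr1; last exact/ltW/divr_gt0.
rewrite powR0 ?gt_eqF// mulr0 add0r mulrCA -[leRHS]mulr1.
rewrite ler_wpM2l ?(ltW (d0 i))//.
by rewrite ler_pdivrMr// mul1r lerDl.
Qed.

Lemma hcontent0 : H set0 = 0.
Proof.
apply/eqP; rewrite eq_le hcontent_ge0 andbT.
apply: le_trans (@hcontent_le _ (fun=> 0%R) (fun=> 0%R) _ _) _ => //.
by rewrite eseries0// => i _ _; rewrite powR0 ?gt_eqF// mulr0.
Qed.

Lemma hcontent_ball (x : 'rV[R]_n) (r : R) : (0 <= r)%R ->
  H (eball x r) <= (omega beta * r `^ beta)%:E.
Proof.
move=> r0.
apply: le_trans (@hcontent_le _ (fun=> x) (fun i => if i == 0%N then r else 0%R) _ _) _.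
- by move=> i; case: ifP.
- by move=> y xy; exists 0%N.
- rewrite (nneseries_split _ 1%N); last by move=> *; exact: ball_term_ge0.
  rewrite big_mkord big_ord1 eqxx eseries0 ?adde0// => -[//|i] _ _.
  by rewrite powR0 ?gt_eqF// mulr0.
Qed.

(** When all contents are finite, each [A i] has a cover that is optimal up to e / 2^(i+1). A
    bijection between [nat] and [nat * nat] merges these covers into one sequence of balls. *)
Lemma hcontent_sigma_subadditive : sigma_subadditive H.
Proof.
move=> A; have [[i Aoo]|Afin] := pselect (exists i, H (A i) = +oo).
  rewrite (eseries_pinfty _ _ Aoo) ?leey// => k _.
  by rewrite -ltNye (lt_le_trans _ (hcontent_ge0 _)).
apply/lee_addgt0Pr => e e0.
apply: le_trans (epsilon_trick _ _ (ltW e0)); last exact: (fun i => hcontent_ge0 (A i)).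
pose P i (B : (nat -> 'rV[R]_n) * (nat -> R)) :=
  [/\ forall j, (0 < B.2 j)%R, A i `<=` \bigcup_j eball (B.1 j) (B.2 j) &
   \sum_(j <oo) (omega beta * B.2 j `^ beta)%:E <=
     H (A i) + (e / (2 ^ i.+1)%:R)%:E].
have [G PG] : {G & forall i, P i (G i)}.
  apply: (@choice _ _ P) => i.
  have e2 : (0 < e / (2 ^ i.+1)%:R :> R)%R by rewrite divr_gt0// ltr0n expn_gt0.
  have Ai : H (A i) \is a fin_num.
    rewrite ge0_fin_numE ?hcontent_ge0// ltey; apply/eqP => Aoo.
    by apply: Afin; exists i.
  have [_ [x [r [r0 Axr ->]]] xr] := lb_ereal_inf_adherent e2 Ai.
  by exists (x, r); split=> //; exact: ltW.
have /card_esym/ppcard_eqP[f] := card_nat2.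
pose a (k : nat * nat) := (omega beta * (G k.1).2 k.2 `^ beta)%:E.
apply: le_trans (@hcontent_le _ (fun k => (G (f k).1).1 (f k).2)
  (fun k => (G (f k).1).2 (f k).2) _ _) _.
- by move=> k; apply/ltW; have [] := PG (f k).1.
- move=> y [i _ Aiy]; have [_ /(_ y Aiy)[j _ xj] _] := PG i.
  by exists (f^-1%FUN (i, j)) => //; rewrite invK ?inE.
- rewrite (nneseries_esumT (a := fun k => a (f k))); last by move=> *; exact: ball_term_ge0.
  rewrite -(reindex_esum setT setT f a)//.
  rewrite (_ : setT = setT `*`` (fun=> setT)); last first.
    by apply/seteqP; split => // -[].
  rewrite -(@esum_esum _ _ _ setT (fun=> setT) (fun i j => a (i, j)))//; last first.
    by move=> *; exact: ball_term_ge0.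
  rewrite -nneseries_esumT; last by move=> *; apply: esum_ge0 => *; exact: ball_term_ge0.
  apply: lee_nneseries => i *; first by apply: esum_ge0 => *; exact: ball_term_ge0.
  rewrite -nneseries_esumT; last by move=> *; exact: ball_term_ge0.
  by have [_ _] := PG i.
Qed.

HB.instance Definition _ := isOuterMeasure.Build R 'rV[R]_n H
  hcontent0 hcontent_ge0 le_hcontent hcontent_sigma_subadditive.

Lemma hcontent_bigsetU (I : Type) (s : seq I) (A : I -> set 'rV[R]_n) E :
  E `<=` \big[setU/set0]_(i <- s) A i -> H E <= \sum_(i <- s) H (A i).
Proof.
move=> EA; apply: le_trans (le_hcontent EA) _.
elim: s {EA} => [|i s ih]; first by rewrite !big_nil hcontent0.
rewrite !big_cons; apply: le_trans (outer_measureU2 _ _ _) _.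
exact: leeD2l.
Qed.

Lemma hcontent_esum (I : countType) (S : set I) (A : I -> set 'rV[R]_n) E :
  E `<=` \bigcup_(i in S) A i -> H E <= \esum_(i in S) H (A i).
Proof.
move=> EA.
(* The family is spread over [nat] along [pickle], with the empty set, of content 0, at all other
   indices. *)
pose B k := if pickle_inv k is Some i then if i \in S then A i else set0 else set0.
have : E `<=` \bigcup_k B k.
  move=> x /EA[i Si Aix]; exists (pickle i) => //.
  by rewrite /B pickleK_inv mem_set.
move=> /le_hcontent/le_trans; apply.
have := @outer_measure_sigma_subadditive _ _ H B; move=> /le_trans; apply.
rewrite nneseries_esumT; last by move=> *; exact: hcontent_ge0.
have -> : \esum_(k in setT) H (B k) = \esum_(k in (@pickle I) @` S) H (B k).
  rewrite [RHS]esum_mkcond; apply: eq_esum => k _; case: ifPn => // /negP kS.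
  rewrite /B; case: pickle_inv (@pickle_invK I k) => [i|]; last by rewrite hcontent0.
  move=> /= ik; case: ifPn => [/set_mem Si|_]; last by rewrite hcontent0.
  by exfalso; apply: kS; apply/mem_set; exists i.
rewrite esum_image; last by move=> i j _ _; exact: (pcan_inj (@pickleK I)).
by apply: le_esum => i Si; rewrite /B pickleK_inv mem_set.
Qed.

End content.

(** * Selection of a packing subfamily in an abstract forest *)

(* Dyadic cubes enter the selection argument only through this interface: [sub]
   is inclusion and [lev] the binary logarithm of the side. *)
Section forest.
Context (I : choiceType) (lev : I -> int) (sub : I -> I -> Prop).
Hypothesis sub_refl : forall i, sub i i.
Hypothesis sub_trans : forall i j k, sub i j -> sub j k -> sub i k.
Hypothesis sub_lev : forall i j, sub i j -> (lev i <= lev j).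
Hypothesis sub_lev_eq : forall i j, sub i j -> lev i = lev j -> i = j.
Hypothesis sub_total : forall i j k, sub i j -> sub i k -> sub j k \/ sub k j.
Implicit Types F S T : set I.

Definition maxes F := [set j | F j /\ forall k, F k -> sub j k -> k = j].

(** A non-maximal element has a strictly higher one above it in [F]; since levels are bounded by
    [m], the climb stops. The induction is on [m - lev i]. *)
Lemma exists_maxes F (m : int) : (forall i, F i -> lev i <= m) ->
  forall i, F i -> exists2 j, maxes F j & sub i j.
Proof.
move=> Fm i Fi.
have [d] := ubnP (absz (m - lev i)%R); elim: d i Fi => // d ih i Fi id.
have [imax|] := pselect (maxes F i); first by exists i.
move/not_andP => -[//|/existsNP[k /not_implyP[Fk /not_implyP[ik /eqP ki]]]].
have lik : (lev i < lev k).
  rewrite lt_neqAle sub_lev// andbT; apply/eqP => /(sub_lev_eq ik) e.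
  by rewrite e eqxx in ki.
have := Fm _ Fk; have := Fm _ Fi => im km.
have [j Fj kj] : exists2 j, maxes F j & sub k j by apply: ih => //; lia.
by exists j => //; exact: sub_trans kj.
Qed.

Lemma maxes_inj F i j k : maxes F j -> maxes F k -> sub i j -> sub i k -> j = k.
Proof.
by move=> [Fj mj] [Fk mk] ij ik; have [/mj->|/mk->] := sub_total ij ik.
Qed.

Lemma finite_sub_chain (C : set (set I)) (X : set I) :
  C !=set0 -> total_on C subset -> finite_set X -> X `<=` \bigcup_(A in C) A ->
  exists2 A, C A & X `<=` A.
Proof.
move=> C0 totC /finite_seqP[s ->]; elim: s => [_|i s ih isC].
  by have [A CA] := C0; exists A.
have [|A CA sA] := ih; first by move=> x xs; apply: isC; rewrite /= inE xs orbT.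
have [|B CB iB] := isC i; first by rewrite /= inE eqxx.
have [AB|BA] := totC _ _ CA CB.
  by exists B => // x /=; rewrite inE => /orP[/eqP->//|/sA/AB].
by exists A => // x /=; rewrite inE => /orP[/eqP->|/sA//]; exact: BA.
Qed.

Context (R : realType) (w : I -> R).
Hypothesis w_gt0 : forall i, 0 < w i.
Hypothesis le_w : forall i j, sub i j -> w i <= w j.
Hypothesis w_infty : forall M : R, exists m : int, forall i, w i <= M -> lev i <= m.

Local Open Scope ereal_scope.

Definition below S j := S `&` [set i | sub i j].

Definition packing S := forall j, \esum_(i in below S j) (w i)%:E <= (2 * w j)%:E.

Let w_ge0 i : 0 <= (w i)%:E. Proof. by rewrite lee_fin ltW. Qed.
Let esum_w_ge0 S : 0 <= \esum_(i in S) (w i)%:E.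
Proof. by apply: esum_ge0 => *; exact: w_ge0. Qed.

Lemma esum_w_subset S S' : S `<=` S' ->
  \esum_(i in S) (w i)%:E <= \esum_(i in S') (w i)%:E.
Proof.
move=> SS'; apply: ge_ereal_sup => _ [X [finX XS] <-].
by apply: esum_ge; exists X => //; split => // x /XS/SS'.
Qed.

(** By Zorn's lemma. Packing survives unions of chains because [\esum] is a supremum over finite
    sets, and a finite subset of the union already lies in one member of the chain. *)
Lemma exists_max_packing G : exists S, [/\ S `<=` G, packing S &
  forall i, G i -> ~ S i -> ~ packing (S `|` [set i])].
Proof.
pose P := [set S | S `<=` G /\ packing S].
have [C CP totC|S [[SG packS] maxS]] := @Zorn_bigcup I P.
  split; first by apply: bigcup_sub => S /CP[].
  move=> j; apply: ge_ereal_sup => _ [X [finX XC] <-].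
  have [C0|/set0P C0] := eqVneq C set0.
    rewrite (_ : X = set0) ?fsbig_set0 ?lee_fin ?mulr_ge0 ?ltW//.
    by rewrite -subset0 => x /XC[]; rewrite C0 bigcup_set0.
  have [|S CS XS] := finite_sub_chain C0 totC finX; first by move=> x /XC[].
  have [_ /(_ j)] := CP _ CS; apply: le_trans.
  by apply: esum_ge; exists X => //; split=> // x Xx; split; [exact: XS|have [] := XC _ Xx].
exists S; split => // i Gi nSi packSi; apply: (maxS (S `|` [set i])).
  by split; [exact: subsetUl|move=> /(_ i) h; apply/nSi/h; right].
by split => // x [/SG//|->].
Qed.

(** If adding [i] breaks the packing bound at [j], then [i] lies below [j], as otherwise [S] itself
    would break it. So [2 * w j] is less than [w i] plus the sum below [j], and [w i <= w j] leaves
    at least [w j] for that sum: this is what the factor 2 in [packing] is for. *)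
Lemma packing_saturated G S : packing S ->
  (forall i, G i -> ~ S i -> ~ packing (S `|` [set i])) ->
  forall i, G i -> exists2 j, sub i j & (w j)%:E <= \esum_(k in below S j) (w k)%:E.
Proof.
move=> packS maxS i Gi; have [Si|nSi] := pselect (S i).
  exists i => //; rewrite -(@esum_set1 _ _ i (fun k => (w k)%:E))//.
  by apply: esum_w_subset => _ ->; split; [exact: Si|exact: sub_refl].
have /existsNP[j /negP] := maxS _ Gi nSi.
rewrite -ltNge => wj.
have [ij|nij] := pselect (sub i j); last first.
  exfalso; move: wj; apply/negP; rewrite -leNgt; apply: le_trans (packS j).
  by apply: esum_w_subset => x [[//|->//]].
exists j => //.
have {}wj : (2 * w j)%:E < (w i)%:E + \esum_(k in below S j) (w k)%:E.
  apply: lt_le_trans wj _; rewrite (esumID [set i])//.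
  apply: leeD; last by apply: esum_w_subset => x [[[Sx|xi] xj] nxi]; [split|case: nxi].
  rewrite -(@esum_set1 _ _ i (fun k => (w k)%:E))//.
  by apply: esum_w_subset => x [].
move: wj; case: (\esum_(k in _) _) (esum_w_ge0 (below S j)) => [r _| _ _|//]; last by rewrite leey.
rewrite -EFinD lte_fin lee_fin; have := le_w ij; lra.
Qed.

(** [T] consists of the maximal saturated indices, those whose weight is at most the sum of [S]
    below them. A finite total weight of [S] bounds their weights, hence their levels, so maximal
    ones exist. Finiteness is a premise of the last clause because it is to be derived from the
    first two. *)
Lemma forest_selection F (m : int) : (forall i, F i -> lev i <= m)%R ->
  exists S, [/\ S `<=` maxes F, packing S &
    \esum_(i in S) (w i)%:E < +oo ->
    exists2 T, \esum_(j in T) (w j)%:E <= \esum_(i in S) (w i)%:E &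
      forall i, F i -> exists2 j, T j & sub i j].
Proof.
move=> Fm; have [S [SG packS maxS]] := exists_max_packing (maxes F).
exists S; split => // Soo.
have Sfin : \esum_(i in S) (w i)%:E \is a fin_num by rewrite ge0_fin_numE.
pose T0 := [set j | (w j)%:E <= \esum_(k in below S j) (w k)%:E].
have [m' m'P] := w_infty (fine (\esum_(i in S) (w i)%:E)).
have T0m j : T0 j -> (lev j <= m')%R.
  move=> T0j; apply: m'P; rewrite -lee_fin fineK//; apply: le_trans T0j _.
  by apply: esum_w_subset => x [].
exists (maxes T0).
  apply: (@le_trans _ _ (\esum_(j in maxes T0) \esum_(k in below S j) (w k)%:E)).
    by apply: le_esum => j [].
  (* Each [k] in [S] lies below at most one maximal [j], so projecting the pairs to [k] is injective
     and no weight is counted twice. *)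
  rewrite esum_esum//.
  rewrite -(esum_image _ (fun jk => jk.2) (fun k => (w k)%:E)).
    by apply: esum_w_subset => _ [[j k] [_ []]] /= Sk _ <-.
  move=> [j k] [j' k'] /set_mem[/= Tj [_ kj]] /set_mem[/= Tj' [_ kj']] /= kk'.
  by rewrite -kk' in kj' *; congr pair; exact: (maxes_inj Tj Tj' kj kj').
move=> i Fi; have [i1 Gi1 ii1] := exists_maxes Fm Fi.
have [j i1j T0j] := packing_saturated packS maxS Gi1.
have [j1 Tj1 jj1] := exists_maxes T0m T0j.
by exists j1 => //; exact/(sub_trans ii1)/(sub_trans i1j).
Qed.

End forest.

(** * Dyadic cubes, their dilates and their neighbours *)

Lemma exists_pow2_scale (R : realType) (r : R) : 0 < r ->
  exists k : int, r <= 2 ^ k <= 2 * r.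
Proof.
move=> r0; have l2 : 0 < ln (2 : R) by rewrite ln_gt0// ltr1n.
pose t := ln r / ln 2.
have rE : r = 2 `^ t.
  by rewrite /powR pnatr_eq0/= /t mulfVK ?gt_eqF// lnK.
have /andP[le_t lt_t] := Num.Theory.floor_itv t.
exists (Num.floor t + 1); rewrite -powR_intmul// rE.
apply/andP; split; first by apply: ler_powR; [rewrite ler1n|exact: ltW].
rewrite rmorphD/= powRD; last by rewrite pnatr_eq0 implybT.
by rewrite powRr1// mulrC ler_wpM2l// ler_powR// ler1n.
Qed.

(** The integer [floor (a / d) * d] is at most [a], hence at most [floor a = floor b], hence at most
    [b]. *)
Lemma le_floor_divn (R : realType) (a b : R) (d : nat) : (0 < d)%N ->
  Num.floor a = Num.floor b -> Num.floor (a / d%:R) <= Num.floor (b / d%:R).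
Proof.
move=> d0 ab; have d0R : 0 < d%:R :> R by rewrite ltr0n.
rewrite Num.Theory.floor_ge_int ler_pdivlMr//.
have -> : (Num.floor (a / d%:R))%:~R * d%:R = (Num.floor (a / d%:R) * d)%:~R :> R.
  by rewrite rmorphM.
rewrite -Num.Theory.floor_ge_int -ab Num.Theory.floor_ge_int rmorphM/=.
by rewrite -ler_pdivlMr// Num.Theory.floor_le.
Qed.

(* [(k, v)] encodes the half-open dyadic cube of side [2 ^ k] with corner
   [2 ^ k * v]. *)
Definition cube n := (int * {ffun 'I_n -> int})%type.

Section cubes.
Context (R : realType) (n : nat).
Implicit Types (P Q : cube n) (x y : 'rV[R]_n) (k : int).

Definition side Q : R := 2 ^ Q.1.

Definition cube_at k x : cube n := (k, [ffun i => Num.floor (x ord0 i / 2 ^ k)]).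

Definition cube_set Q : set 'rV[R]_n := [set x | cube_at Q.1 x = Q].

(** Comparing levels as well keeps the order antisymmetric for [n = 0], where all cubes are the same
    one-point set. *)
Definition cube_le P Q := P.1 <= Q.1 /\ cube_set P `<=` cube_set Q.

Lemma side_gt0 Q : 0 < side Q. Proof. exact: exprz_gt0. Qed.

Lemma cube_set_neq0 Q : cube_set Q !=set0.
Proof.
exists (\row_i ((Q.2 i)%:~R * side Q)); rewrite /cube_set /= /cube_at.
rewrite [RHS]surjective_pairing; congr pair; apply/ffunP => i.
by rewrite !ffunE mxE mulfK ?intrKfloor// gt_eqF// side_gt0.
Qed.

(** Going from level [k] to [k'] divides by a natural power of 2, and the floor after such a
    division depends only on the floor before it. *)
Lemma cube_at_nested k k' x y : k <= k' ->
  cube_at k x = cube_at k y -> cube_at k' x = cube_at k' y.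
Proof.
move=> kk' [] /ffunP xy; congr pair; apply/ffunP => i.
move/(_ i) : xy; rewrite !ffunE => xyi.
have -> : 2 ^ k' = 2 ^ k * (2 ^ absz (k' - k))%N%:R :> R.
  rewrite natrX exprnP -expfzDr ?pnatr_eq0//; congr (2 ^ _); lia.
rewrite !invfM !mulrA; apply/eqP.
by rewrite eq_le !le_floor_divn ?expn_gt0.
Qed.

Lemma cube_meet_le P Q x : P.1 <= Q.1 -> cube_set P x -> cube_set Q x -> cube_le P Q.
Proof.
move=> PQ Px Qx; split => // y Py; rewrite /cube_set/= -[RHS]Qx.
by apply: cube_at_nested PQ _; rewrite Py Px.
Qed.

Lemma cube_meet P Q x : cube_set P x -> cube_set Q x -> cube_le P Q \/ cube_le Q P.
Proof.
by move=> Px Qx; have [/cube_meet_le|/ltW/cube_meet_le] := leP P.1 Q.1;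
  move=> /(_ x); [left|right]; eauto.
Qed.

Lemma cube_le_refl Q : cube_le Q Q. Proof. by split. Qed.

Lemma cube_le_trans P Q S : cube_le P Q -> cube_le Q S -> cube_le P S.
Proof.
by move=> [PQ sPQ] [QS sQS]; split; [exact: le_trans QS|exact: subset_trans sQS].
Qed.

Lemma cube_le_lev P Q : cube_le P Q -> P.1 <= Q.1. Proof. by case. Qed.

Lemma cube_le_lev_eq P Q : cube_le P Q -> P.1 = Q.1 -> P = Q.
Proof.
move=> [_ PQ] lPQ; have [x Px] := cube_set_neq0 P.
by rewrite -[P]Px -(PQ _ Px) lPQ.
Qed.

Lemma cube_le_total P Q S : cube_le P Q -> cube_le P S -> cube_le Q S \/ cube_le S Q.
Proof.
move=> [_ PQ] [_ PS]; have [x Px] := cube_set_neq0 P.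
exact: (cube_meet (PQ _ Px) (PS _ Px)).
Qed.

Lemma le_side P Q : P.1 <= Q.1 -> side P <= side Q.
Proof. by move=> PQ; rewrite /side ler_eXz2l// ltr1n. Qed.

(** Two sides per coordinate is the reach that [nbrs_dil] needs: a point is that close to every cube
    adjacent to its own. *)
Definition dil Q : set 'rV[R]_n :=
  [set x | exists2 y, cube_set Q y & forall i, `|x ord0 i - y ord0 i| <= 2 * side Q].

Lemma cube_set_dil Q : cube_set Q `<=` dil Q.
Proof.
move=> x Qx; exists x => // i; rewrite subrr normr0 mulr_ge0//.
by rewrite ltW// side_gt0.
Qed.

Lemma dil_le P Q : cube_le P Q -> dil P `<=` dil Q.
Proof.
move=> [lPQ PQ] x [y Py xy]; exists y; first exact: PQ.
by move=> i; apply: le_trans (xy i) _; rewrite ler_pM2l// le_side.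
Qed.

Lemma cube_set_coord Q x i : cube_set Q x ->
  (Q.2 i)%:~R * side Q <= x ord0 i < ((Q.2 i)%:~R + 1) * side Q.
Proof.
move=> Qx; rewrite -ler_pdivlMr ?side_gt0// -ltr_pdivrMr ?side_gt0//.
have -> : Q.2 i = Num.floor (x ord0 i / side Q) by rewrite -[in LHS]Qx /= ffunE.
by have := Num.Theory.floor_itv (x ord0 i / side Q); rewrite rmorphD.
Qed.

Lemma cube_set_near Q x y i : cube_set Q x -> cube_set Q y ->
  `|x ord0 i - y ord0 i| <= side Q.
Proof.
move=> /cube_set_coord-/(_ i) + /cube_set_coord-/(_ i); rewrite ler_norml.
lra.
Qed.

(** A point of [dil Q] is within 2 + 1 sides, in each coordinate, of any fixed point of [Q], so its
    Euclidean distance is at most 3n sides. The final 1 makes room for the strict inequality of an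
    open ball. *)
Definition dil_const : R := 3 * n%:R + 1.

Lemma dil_const_gt0 : 0 < dil_const.
Proof. by rewrite /dil_const ltr_wpDl// mulr_ge0// ler0n. Qed.

Lemma dil_eball Q : exists y, dil Q `<=` eball y (dil_const * side Q).
Proof.
have [y Qy] := cube_set_neq0 Q; exists y => x [z Qz xz].
have s0 := side_gt0 Q; have c0 := dil_const_gt0.
have cs0 : 0 < dil_const * side Q by rewrite mulr_gt0.
rewrite /eball /= -[ltRHS]ger0_norm ?ltW// -sqrtr_sqr ltr_sqrt ?exprn_gt0//.
apply: (@le_lt_trans _ _ (\sum_(i < n) (3 * side Q) ^+ 2)).
  apply: ler_sum => i _; rewrite -real_normK ?num_real// lerXn2r ?nnegrE ?mulr_ge0 ?(ltW s0)//.
  have := cube_set_near i Qz Qy; have := xz i; rewrite !ler_norml; lra.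
rewrite sumr_const card_ord -mulr_natl /dil_const.
have nn : n%:R <= n%:R ^+ 2 :> R by rewrite -natrX ler_nat; case: (n) => // m; rewrite leq_pmull.
have n0 : 0 <= n%:R :> R by [].
have s2 : 0 < side Q ^+ 2 by rewrite exprn_gt0.
have : n%:R * side Q ^+ 2 <= n%:R ^+ 2 * side Q ^+ 2 by rewrite ler_wpM2r// ltW.
have : 0 <= n%:R * side Q ^+ 2 by rewrite mulr_ge0// ltW.
rewrite !exprMn sqrrD; lra.
Qed.

Lemma eball_coord x r y i : eball x r y -> `|y ord0 i - x ord0 i| < r.
Proof.
rewrite /eball /=; apply: le_lt_trans; rewrite -sqrtr_sqr ler_wsqrtr//.
by rewrite (bigD1 i)//= lerDl sumr_ge0// => j _; rewrite sqr_ge0.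
Qed.

Definition nbrs k x : seq (cube n) :=
  [seq (k, [ffun i => (cube_at k x).2 i + (e i)%:Z - 1]) | e : {ffun 'I_n -> 'I_3}].

Lemma size_nbrs k x : size (nbrs k x) = (3 ^ n)%N.
Proof. by rewrite size_image card_ffun !card_ord. Qed.

Lemma nbrs_lev k x Q : Q \in nbrs k x -> Q.1 = k.
Proof. by rewrite /nbrs => /fintype.imageP[e _ ->]. Qed.

(** Coordinates differing by less than [2 ^ k] have cube indices differing by at most 1; [t] shifts
    this difference into 0, 1, 2. *)
Lemma eball_nbrs k x r y : r <= 2 ^ k -> eball x r y -> cube_at k y \in nbrs k x.
Proof.
move=> rk xy; pose t i := Num.floor (y ord0 i / 2 ^ k) - Num.floor (x ord0 i / 2 ^ k) + 1.
have tP i : 0 <= t i < 3.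
  have k0 : 0 < 2 ^ k :> R by rewrite exprz_gt0.
  have : `|y ord0 i / 2 ^ k - x ord0 i / 2 ^ k| < 1.
    rewrite -mulrBl normrM [X in _ * X]gtr0_norm ?invr_gt0//.
    by rewrite ltr_pdivrMr// mul1r (lt_le_trans (eball_coord i xy)).
  have := Num.Theory.floor_itv (y ord0 i / 2 ^ k).
  have := Num.Theory.floor_itv (x ord0 i / 2 ^ k).
  rewrite /t; set a := Num.floor _; set b := Num.floor _.
  rewrite !rmorphD/= ltr_norml => xa yb xy1.
  have : - 2 < (b - a)%:~R :> R by rewrite rmorphB/=; lra.
  have : (b - a)%:~R < 2 :> R by rewrite rmorphB/=; lra.
  rewrite (_ : - 2 = (- 2)%:~R :> R)// ltr_int (_ : 2 = 2%:~R :> R)// ltr_int; lia.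
apply/fintype.imageP; exists [ffun i => inord (absz (t i))] => //.
congr pair; apply/ffunP => i; rewrite !ffunE inordK; last by have := tP i; lia.
have := tP i; rewrite /t; lia.
Qed.

Lemma nbrs_dil k x Q : Q \in nbrs k x -> dil Q x.
Proof.
rewrite /nbrs => /fintype.imageP[e _ QE]; have [y Qy] := cube_set_neq0 Q; exists y => // i.
have := cube_set_coord i Qy.
have := @cube_set_coord (cube_at k x) x i erefl.
rewrite QE /= !ffunE /side/= !rmorphD/= rmorphN/=.
set s := 2 ^ k; set a := (Num.floor _)%:~R.
have s0 : 0 < s by rewrite exprz_gt0.
have : (e i)%:~R * s <= 2 * s by rewrite ler_pM2r// (ler_int _ _ 2) lez_nat -ltnS.
have : 0 <= (e i)%:~R * s by rewrite mulr_ge0 ?ler0z// ltW.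
rewrite ler_norml; lra.
Qed.

Lemma eball_sub_nbrs k x r : r <= 2 ^ k ->
  eball x r `<=` \big[setU/set0]_(Q <- nbrs k x) cube_set Q.
Proof.
by move=> rk y xy; rewrite -bigcup_seq; exists (cube_at k y) => //=; exact: (eball_nbrs rk).
Qed.

End cubes.

(** * Superadditivity of the content along packing families *)

Section packing_content.
Context (R : realType) (n : nat) (beta : R).
Hypothesis beta_gt0 : 0 < beta.
Local Notation H := (@hcontent R n beta).
Implicit Types (P Q : cube n) (E : set 'rV[R]_n).

Definition wgt Q : R := side R Q `^ beta.

Lemma wgt_gt0 Q : 0 < wgt Q. Proof. by rewrite powR_gt0 ?side_gt0. Qed.

Lemma le_wgt P Q : cube_le R P Q -> wgt P <= wgt Q.
Proof.
move=> /cube_le_lev/(le_side R) PQ.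
by rewrite ge0_ler_powR ?(ltW beta_gt0)// nnegrE ltW// side_gt0.
Qed.

Lemma wgt_infty (M : R) : exists m : int, forall Q, wgt Q <= M -> Q.1 <= m.
Proof.
exists (Num.floor (`|M| `^ beta^-1)) => Q QM; rewrite Num.Theory.floor_ge_int.
(* The level is at most the side: k <= 2^k for natural k, and a negative level is below any positive
   side. *)
apply: (@le_trans _ _ (side R Q)).
  rewrite /side; case: Q.1 => [k|k].
    by rewrite -exprnP -pmulrn -natrX ler_nat ltnW// ltn_expl.
  apply: (@le_trans _ _ 0); last by rewrite ltW// exprz_gt0.
  by rewrite lerz0.
rewrite -[leLHS]powRr1 ?(ltW (side_gt0 _ _))// -(@divff _ beta) ?gt_eqF// powRrM.
rewrite ge0_ler_powR ?invr_ge0 ?(ltW beta_gt0)// ?nnegrE ?powR_ge0//.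
exact: le_trans QM (ler_norm _).
Qed.

Definition dil_cost : R := omega beta * dil_const R n `^ beta.

Lemma dil_cost_ge0 : 0 <= dil_cost.
Proof. by rewrite mulr_ge0 ?omega_ge0 ?powR_ge0. Qed.

Local Open Scope ereal_scope.

Lemma hcontent_dil Q : H (dil Q) <= (dil_cost * wgt Q)%:E.
Proof.
have [y Qy] := dil_eball R Q; apply: le_trans (le_hcontent _ Qy) _.
have c0 := ltW (dil_const_gt0 R n); have s0 := ltW (side_gt0 R Q).
apply: le_trans (hcontent_ball beta_gt0 y (mulr_ge0 c0 s0)) _.
by rewrite powRM// mulrA.
Qed.

Lemma hcontent_cube Q : H (cube_set Q) <= (dil_cost * wgt Q)%:E.
Proof. exact: le_trans (le_hcontent _ (@cube_set_dil R n Q)) (hcontent_dil Q). Qed.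

Context (S : set (cube n)).
Hypothesis S_incomparable : forall P Q, S P -> S Q -> cube_le R P Q -> P = Q.
Hypothesis S_packing : packing (@cube_le R n) wgt S.

(* A cube of the family meeting [P] either lies in [P], where the packing
   condition applies, or contains [P], and then it is the only one. *)
Lemma packing_sum_cube (s : seq (cube n)) P : uniq s -> {in s, forall Q, S Q} ->
  \sum_(Q <- s) H (cube_set P `&` cube_set Q) <= (3 * dil_cost * wgt P)%:E.
Proof.
move=> us sS.
rewrite (bigID (fun Q => `[< cube_le R Q P >]))/=.
rewrite (_ : 3 * dil_cost * wgt P = 2 * dil_cost * wgt P + dil_cost * wgt P)%R; last by ring.
rewrite EFinD; apply: leeD.
  apply: (@le_trans _ _ (\sum_(Q <- s | `[< cube_le R Q P >]) (dil_cost * wgt Q)%:E)).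
    apply: lee_sum => Q _; apply: le_trans (hcontent_cube Q).
    by apply: le_hcontent; exact: subIsetr.
  rewrite sumEFin -mulr_sumr -mulrA mulrCA lee_fin ler_wpM2l ?dil_cost_ge0//.
  rewrite -lee_fin; apply: le_trans (S_packing P).
  rewrite -sumEFin -big_filter; apply: esum_ge.
  exists [set` [seq Q <- s | `[< cube_le R Q P >]]].
    split; first exact: finite_seq.
    by move=> Q /=; rewrite mem_filter => /andP[/asboolP QP /sS].
  by rewrite fsbig_seq// filter_uniq.
have [/hasP[Q0 Q0s /andP[/asboolPn nQ0 /asboolP PQ0]]|/hasPn sP] :=
    boolP (has (fun Q => ~~ `[< cube_le R Q P >] && `[< cube_le R P Q >]) s).
  rewrite big_mkcond (bigD1_seq Q0)//= asboolF//= big_seq_cond big1 ?adde0.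
    apply: le_trans (hcontent_cube P); by apply: le_hcontent; exact: subIsetl.
  move=> Q /andP[Qs /eqP QQ0]; case: ifPn => // /asboolPn nQ.
  rewrite (_ : _ `&` _ = set0) ?hcontent0// -subset0 => x [Px Qx]; apply: QQ0.
  have [PQ|//] := cube_meet Px Qx.
  have [QQ0|QQ0] := cube_le_total PQ PQ0.
    by apply: S_incomparable => //; exact: sS.
  by apply/esym; apply: S_incomparable => //; exact: sS.
rewrite big_seq_cond big1; first by rewrite lee_fin mulr_ge0 ?dil_cost_ge0// ltW// wgt_gt0.
move=> Q /andP[Qs /asboolPn nQ].
rewrite (_ : _ `&` _ = set0) ?hcontent0// -subset0 => x [Px Qx].
have nPQ : ~ cube_le R P Q.
  move=> PQ; move/negP: (sP _ Qs); apply; apply/andP.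
  by split; [exact/asboolPn|exact/asboolP].
by have [] := cube_meet Px Qx.
Qed.

(** The factor 3 is the cost per cube in [packing_sum_cube]. A ball of radius r is covered by
    [3 ^+ n] cubes of side at most 2r, and [dil_const] comes from [dil_cost], whose [omega beta]
    goes into the cost of the ball. *)
Definition packing_const : R := 3 * 3 ^+ n * (2 * dil_const R n) `^ beta.

Lemma packing_const_ge0 : (0 <= packing_const)%R.
Proof. by rewrite /packing_const !mulr_ge0 ?powR_ge0 ?exprn_ge0. Qed.

Lemma packing_sum_ball (s : seq (cube n)) x (r : R) :
  uniq s -> {in s, forall Q, S Q} -> (0 < r)%R ->
  \sum_(Q <- s) H (eball x r `&` cube_set Q) <=
  (packing_const * (omega beta * r `^ beta))%:E.
Proof.
move=> us sS r0; have [k /andP[rk kr]] := exists_pow2_scale r0.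
apply: (@le_trans _ _ (\sum_(P <- nbrs k x) \sum_(Q <- s) H (cube_set P `&` cube_set Q))).
  rewrite exchange_big/=; apply: lee_sum => Q _.
  apply: (hcontent_bigsetU beta_gt0) => y [xy Qy].
  by have := eball_sub_nbrs rk xy; rewrite -!bigcup_seq => -[P]; exists P.
apply: (@le_trans _ _ (\sum_(P <- nbrs k x) (3 * dil_cost * (2 * r) `^ beta)%:E)).
  rewrite !big_seq; apply: lee_sum => P Pk.
  apply: le_trans (packing_sum_cube P us sS) _.
  rewrite lee_fin ler_wpM2l ?(mulr_ge0 _ dil_cost_ge0)//.
  have {}kr : (side R P <= 2 * r)%R by rewrite /side (nbrs_lev Pk).
  by rewrite /wgt ge0_ler_powR ?nnegrE ?(ltW beta_gt0)// ?(ltW (side_gt0 _ _))// mulr_ge0// ltW.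
rewrite sumEFin big_const_seq count_predT size_nbrs iter_addr addr0 lee_fin.
rewrite /packing_const /dil_cost !powRM ?(ltW r0) ?(ltW (dil_const_gt0 _ _))//.
by rewrite -[leLHS]mulr_natl natrX le_eqVlt; apply/orP; left; apply/eqP; ring.
Qed.

(** Every cover of [E] by balls splits each [E] part in a cube by subadditivity; after exchanging
    the sums, [packing_sum_ball] applies ball by ball. *)
Lemma packing_sum (s : seq (cube n)) E : uniq s -> {in s, forall Q, S Q} ->
  \sum_(Q <- s) H (E `&` cube_set Q) <= packing_const%:E * H E.
Proof.
move=> us sS.
have pc0 : (0 < packing_const)%R.
  by rewrite /packing_const !mulr_gt0 ?exprn_gt0 ?powR_gt0 ?mulr_gt0 ?dil_const_gt0.
rewrite -lee_pdivrMl//; apply: le_ereal_inf_tmp => _ [x [r [r0 Exr ->]]].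
rewrite lee_pdivrMl// -nneseriesZl; last by move=> i _; exact: ball_term_ge0.
apply: (@le_trans _ _ (\sum_(Q <- s) \sum_(i <oo) H (eball (x i) (r i) `&` cube_set Q))).
  apply: lee_sum => Q _.
  have := @hcontent_sigma_subadditive _ _ _ beta_gt0 (fun i => eball (x i) (r i) `&` cube_set Q).
  by apply: le_trans; apply: le_hcontent; rewrite -setI_bigcupl; apply: setSI.
rewrite -nneseries_sum; last by move=> *; exact: hcontent_ge0.
apply: lee_nneseries => [i _ _|i _]; first by apply: sume_ge0 => *; exact: hcontent_ge0.
exact: packing_sum_ball.
Qed.

End packing_content.

(** * Integrated layers and the weak estimate for them *)

Lemma nonincreasing_emeasurable (R : realType) (D : set R) (f : R -> \bar R) :
  measurable D -> (forall s t, s <= t -> (f t <= f s)%E) -> measurable_fun D f.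
Proof.
move=> mD f_ni; apply: (measurability _ (ErealGenOInfty.measurableE R)).
move=> _ [_ [r ->] <-]; apply: measurableI => //; apply: is_interval_measurable.
move=> s t /=; rewrite !in_itv/= !andbT => fs ft u /andP[su ut].
by rewrite in_itv/= andbT (lt_le_trans ft)// f_ni.
Qed.

Lemma le_esumZl (R : realType) (I : choiceType) (S : set I) (k : R) (a : I -> \bar R) :
  0 <= k -> (forall i, 0 <= a i)%E ->
  (\esum_(i in S) (k%:E * a i) <= k%:E * \esum_(i in S) a i)%E.
Proof.
move=> k0 a0; apply: ge_ereal_sup => _ [X [finX XS] <-].
rewrite fsbig_finite//= -ge0_sume_distrr// lee_wpmul2l ?lee_fin//.
by apply: esum_ge; exists X => //; rewrite fsbig_finite.
Qed.

Section layers.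
Context (R : realType) (n : nat) (beta : R).
Hypothesis beta_gt0 : 0 < beta.
Local Notation H := (@hcontent R n beta).
Local Notation mu := (@lebesgue_measure R).
Context (E : R -> set 'rV[R]_n).
Hypothesis E_ni : forall s t, s <= t -> E t `<=` E s.
Local Open Scope ereal_scope.

(* The Choquet integral over [A] of the part above height [a] of a function
   whose superlevel sets are the [E s]. *)
Definition tail (a : R) (A : set 'rV[R]_n) : \bar R :=
  \int[mu]_(s in `]a, +oo[) H (E s `&` A).

Lemma measurable_layers (D : set R) A :
  measurable D -> measurable_fun D (fun s => H (E s `&` A)).
Proof.
move=> mD; apply: nonincreasing_emeasurable => // s t st.
by apply: le_hcontent; apply: setSI; exact: E_ni.
Qed.

Lemma tail_ge0 a A : 0 <= tail a A.
Proof. by apply: integral_ge0 => s _; exact: hcontent_ge0. Qed.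

Lemma le_tail a A B : A `<=` B -> tail a A <= tail a B.
Proof.
move=> AB; apply: ge0_le_integral => //; try exact: measurable_layers.
- by move=> *; exact: hcontent_ge0.
- by move=> *; apply: le_hcontent; exact: setIS.
Qed.

Lemma tail_bigsetU a (I : Type) (s : seq I) (A : I -> set 'rV[R]_n) B :
  B `<=` \big[setU/set0]_(i <- s) A i -> tail a B <= \sum_(i <- s) tail a (A i).
Proof.
move=> BA; rewrite -ge0_integral_sum//; last 2 first.
- by move=> i; exact: measurable_layers.
- by move=> *; exact: hcontent_ge0.
apply: ge0_le_integral => //.
- by move=> *; exact: hcontent_ge0.
- exact: measurable_layers.
- by apply: emeasurable_sum => i; exact: measurable_layers.
move=> t _; apply: (hcontent_bigsetU beta_gt0).
by rewrite -big_distrr/=; exact: setIS.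
Qed.

(** The constant in [packing_sum] does not depend on the height, so that bound integrates over the
    layers. *)
Lemma tail_packing a (S : set (cube n)) (s : seq (cube n)) :
  (forall P Q, S P -> S Q -> cube_le R P Q -> P = Q) ->
  packing (@cube_le R n) (wgt beta) S -> uniq s -> {in s, forall Q, S Q} ->
  \sum_(Q <- s) tail a (cube_set Q) <= (packing_const n beta)%:E * tail a setT.
Proof.
move=> Sinc Spack us sS; rewrite -ge0_integral_sum//; last 2 first.
- by move=> i; exact: measurable_layers.
- by move=> *; exact: hcontent_ge0.
rewrite -ge0_integralZl_EFin//; last 3 first.
- by move=> *; exact: hcontent_ge0.
- exact: measurable_layers.
- exact: packing_const_ge0.
apply: ge0_le_integral => //.
- by move=> *; apply: sume_ge0 => *; exact: hcontent_ge0.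
- by apply: emeasurable_sum => i; exact: measurable_layers.
- by apply: measurable_funeM; exact: measurable_layers.
by move=> t _; rewrite setIT; exact: (packing_sum beta_gt0 Sinc Spack).
Qed.

Definition weak_const : R :=
  3 ^+ n * 2 `^ beta * dil_const R n `^ beta * packing_const n beta.

Lemma weak_const_gt0 : (0 < weak_const)%R.
Proof.
by rewrite /weak_const /packing_const !mulr_gt0 ?exprn_gt0 ?powR_gt0 ?mulr_gt0 ?dil_const_gt0.
Qed.

Lemma tail_weak a t : (0 < omega beta)%R -> (0 < t)%R ->
  H [set x | exists2 r : R, (0 < r)%R &
       (t * (omega beta * r `^ beta))%:E < tail a (eball x r)]
  <= (weak_const / t)%:E * tail a setT.
Proof.
move=> w0 t0; set A := [set x | _].
have [->|Ifin] := eqVneq (tail a setT) +oo.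
  by rewrite gt0_muley ?leey// lte_fin divr_gt0// weak_const_gt0.
have {}Ifin : tail a setT \is a fin_num by rewrite ge0_fin_numE ?tail_ge0// ltey.
pose tau := (t * omega beta / (3 ^+ n * 2 `^ beta))%R.
have tau0 : (0 < tau)%R.
  by apply: divr_gt0; rewrite mulr_gt0 ?exprn_gt0 ?powR_gt0.
pose F := [set Q : cube n | (tau * wgt beta Q)%:E < tail a (cube_set Q)].
have AF x : A x -> exists2 Q, F Q & dil Q x.
  move=> [r r0]; rewrite ltNge => /negP xr; apply: contra_notP xr => nF.
  have [k /andP[rk kr]] := exists_pow2_scale r0.
  apply: le_trans (tail_bigsetU a (eball_sub_nbrs rk)) _.
  apply: (@le_trans _ _ (\sum_(P <- nbrs k x) (tau * (2 * r) `^ beta)%:E)).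
    rewrite !big_seq; apply: lee_sum => P Pk.
    have /negP : ~ F P by move=> FP; apply: nF; exists P => //; exact: nbrs_dil Pk.
    rewrite -leNgt => /le_trans; apply; rewrite lee_fin ler_pM2l//.
    have {}kr : (side R P <= 2 * r)%R by rewrite /side (nbrs_lev Pk).
    by rewrite /wgt ge0_ler_powR ?nnegrE ?(ltW beta_gt0)// ?(ltW (side_gt0 _ _))// mulr_ge0// ltW.
  rewrite sumEFin big_const_seq count_predT size_nbrs iter_addr addr0 lee_fin.
  rewrite -[leLHS]mulr_natl natrX powRM ?(ltW r0)// /tau le_eqVlt; apply/orP; left.
  by apply/eqP; field; rewrite ?gt_eqF ?exprn_gt0 ?powR_gt0.
(* The total tail is finite here, so cubes in [F] have bounded weight and therefore bounded
   level. *)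
have [m mP] := wgt_infty n beta_gt0 (fine (tail a setT) / tau).
have Fm Q : F Q -> (Q.1 <= m)%R.
  move=> FQ; apply: mP; rewrite ler_pdivlMr// mulrC -lee_fin fineK//.
  by apply: le_trans (ltW FQ) _; exact: le_tail.
have [S [SF Spack ST]] := @forest_selection _ (fun Q : cube n => Q.1)
  (@cube_le R n) (@cube_le_refl R n) (@cube_le_trans R n) (@cube_le_lev R n)
  (@cube_le_lev_eq R n) (@cube_le_total R n) R (wgt beta) (wgt_gt0 beta)
  (le_wgt beta_gt0) (wgt_infty n beta_gt0) F m Fm.
(* Members of [S] are maximal in [F], hence pairwise incomparable. *)
have Sinc P Q : S P -> S Q -> cube_le R P Q -> P = Q.
  by move=> /SF[FP mP'] /SF[FQ _] PQ; exact/esym/mP'.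
have Sw : \esum_(Q in S) (wgt beta Q)%:E <=
    (packing_const n beta / tau)%:E * tail a setT.
  apply: ge_ereal_sup => _ [X [finX XS] <-].
  rewrite mulrC EFinM -muleA lee_pdivlMl//.
  rewrite fsbig_finite//= ge0_sume_distrr; last first.
    by move=> Q _; rewrite lee_fin ltW// wgt_gt0.
  have XSin : {in finmap.enum_fset (fset_set X), forall Q, S Q}.
    by move=> Q; rewrite in_fset_set// => /set_mem/XS.
  apply: le_trans (tail_packing a Sinc Spack (finmap.fset_uniq _) XSin).
  rewrite !big_seq; apply: lee_sum => Q; rewrite in_fset_set// => /set_mem/XS/SF[FQ _].
  exact: ltW.
have [|T Tw FT] := ST.
  apply: le_lt_trans Sw _; rewrite -(fineK Ifin) -EFinM ltry//.
apply: (@le_trans _ _ (\esum_(Q in T) H (dil Q))).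
  apply: (hcontent_esum beta_gt0) => x /AF[P FP Px].
  by have [Q TQ PQ] := FT _ FP; exists Q => //; exact: (dil_le PQ).
have Tdil : \esum_(Q in T) H (dil Q) <=
    (dil_cost n beta)%:E * \esum_(Q in T) (wgt beta Q)%:E.
  apply: le_trans (le_esumZl _ _ _); last 2 first.
  - exact: dil_cost_ge0.
  - by move=> Q; rewrite lee_fin ltW// wgt_gt0.
  by apply: le_esum => Q _; rewrite -EFinM; exact: hcontent_dil.
apply: le_trans Tdil _; have dc0 := dil_cost_ge0 n beta.
apply: (@le_trans _ _ ((dil_cost n beta)%:E * ((packing_const n beta / tau)%:E * tail a setT))).
  by apply: lee_wpmul2l; [rewrite lee_fin|exact: le_trans Sw].
rewrite muleA -EFinM le_eqVlt; apply/orP; left; apply/eqP.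
congr (_%:E * _); rewrite /weak_const /dil_cost /tau.
by field; rewrite ?gt_eqF ?exprn_gt0 ?powR_gt0.
Qed.

End layers.

(** * Dilations, dyadic decomposition and geometric series *)

Section integral_lemmas.
Context (R : realType).
Local Notation mu := (@lebesgue_measure R).
Local Open Scope ereal_scope.

(** Lebesgue measure is [l] times its pushforward under multiplication by [l], by uniqueness on
    half-open intervals; the rest is integration against a pushforward. *)
Lemma ge0_integral_dilation (l : R) (g : R -> \bar R) : (0 < l)%R ->
  measurable_fun (`]0%R, +oo[ : set (measurableTypeR R)) g -> (forall u, 0 <= g u) ->
  \int[mu]_(u in `]0%R, +oo[) g (l * u)%R =
  (l^-1)%:E * \int[mu]_(u in `]0%R, +oo[) g u.
Proof.
move=> l0 mg g0; pose phi (u : measurableTypeR R) : measurableTypeR R := (l * u)%R.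
have mphi : measurable_fun setT phi by exact: measurable_funM.
have l0' : (0 <= l)%R by exact: ltW.
pose nu : {measure set (measurableTypeR R) -> \bar R} :=
  measure_function_pushforward__canonical__measure_function_Measure mu mphi.
have -> : \int[mu]_(u in `]0%R, +oo[) g u = \int[mscale (NngNum l0') nu]_(u in `]0%R, +oo[) g u.
  apply: eq_measure_integral => A mA _.
  apply: (@lebesgue_measure_unique _ (mscale (NngNum l0') nu)) => // _ [[a b] _ <-] /=.
  rewrite /mscale /= /pushforward.
  rewrite (_ : phi @^-1` _ = `](a / l)%R, (b / l)%R]%classic); last first.
    apply/seteqP; split => u /=; rewrite /phi !in_itv/=;
      by rewrite ltr_pdivrMr// ler_pdivlMr// mulrC.
  rewrite !lebesgue_measure_itv/= !lte_fin ltr_pM2r ?invr_gt0//.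
  case: ifPn => _; last by rewrite mule0.
  by rewrite -!EFinB -EFinM -mulrBl mulrCA divff ?gt_eqF// mulr1.
rewrite ge0_integral_mscale// muleA -EFinM mulVf ?gt_eqF// mul1e.
rewrite ge0_integral_pushforward//.
rewrite (_ : phi @^-1` _ = `]0%R, +oo[%classic)//.
by apply/seteqP; split => u /=; rewrite /phi !in_itv/= !andbT pmulr_rgt0.
Qed.

(** On the interval from a 2^k to a 2^(k+1), of length a 2^k, a nonincreasing [h] is at most its
    value at the left end. *)
Lemma integral_dyadic (h : R -> \bar R) (a : R) : (0 < a)%R ->
  (forall s, 0 <= h s) -> (forall s t, (s <= t)%R -> h t <= h s) ->
  \int[mu]_(s in `]a, +oo[) h s <= \sum_(k <oo) (a * 2 ^+ k)%:E * h (a * 2 ^+ k)%R.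
Proof.
move=> a0 h0 h_ni.
pose A k := `](a * 2 ^+ k)%R, (a * 2 ^+ k.+1)%R]%classic : set (measurableTypeR R).
have mA k : measurable (A k) by exact: measurable_itv.
have mterm k : measurable_fun (`]a, +oo[ : set (measurableTypeR R)) (fun s : R => h (a * 2 ^+ k)%R * (\1_(A k) s)%:E).
  by apply: measurable_funeM; apply/measurable_EFinP; exact: measurable_indic.
have term0 k s : 0 <= h (a * 2 ^+ k)%R * (\1_(A k) s)%:E.
  by rewrite mule_ge0// lee_fin.
apply: (@le_trans _ _ (\int[mu]_(s in `]a, +oo[) \sum_(k <oo) h (a * 2 ^+ k)%R * (\1_(A k) s)%:E)).
  apply: ge0_le_integral => //.
  - exact: nonincreasing_emeasurable.
  - exact: ge0_emeasurable_sum.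
  move=> s /=; rewrite in_itv/= andbT => sa.
  (* The least such [k] puts [s] in [A k]: minimality gives the left bound, and for [k = 0] it is
     [a < s]. *)
  have exk : exists k, (s <= a * 2 ^+ k.+1)%R.
    exists (Num.truncn (s / a)); rewrite mulrC -ler_pdivrMr//.
    apply: le_trans (ltW (truncnS_gt (s / a))) _.
    by rewrite -natrX ler_nat ltnW// ltn_expl.
  have [k sk mink] := ex_minnP exk.
  apply: le_trans (nneseries_lim_ge k.+1 _); last by move=> *; exact: term0.
  rewrite big_nat_recr//=; apply: le_trans (leeDr _ _); last first.
    by apply: sume_ge0 => *; exact: term0.
  have ks : (a * 2 ^+ k < s)%R.
    case: k sk mink => [|k] sk mink; first by rewrite expr0 mulr1.
    by rewrite ltNge; apply/negP => /mink; rewrite ltnn.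
  rewrite indicE mem_set ?mule1; last by rewrite /A /= in_itv/= ks.
  exact/h_ni/ltW.
rewrite integral_nneseries//.
apply: lee_nneseries => k *; first by apply: integral_ge0 => *; exact: term0.
rewrite ge0_integralZl//; last by apply/measurable_EFinP; exact: measurable_indic.
rewrite integral_indic// muleC lee_wpmul2r//.
apply: (@le_trans _ _ (mu (A k))).
  by apply: le_measure; rewrite ?inE//; exact: measurableI.
rewrite lebesgue_measure_itv/= lte_fin ltr_pM2l// ltr_eXn2l ?ltr1n// ltnSn.
rewrite -EFinB lee_fin exprS; lra.
Qed.

Lemma geometric_nneseries (a z : R) : (0 <= a)%R -> (0 <= z < 1)%R ->
  \sum_(k <oo) (a * z ^+ k)%:E = (a / (1 - z))%:E.
Proof.
move=> a0 /andP[z0 z1]; have z1' : (`|z| < 1)%R by rewrite ger0_norm.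
have cz := @cvg_geometric_series R a z z1'.
rewrite -(cvg_lim _ cz)// -EFin_lim; last by apply/cvg_ex; eexists; exact: cz.
by apply: congr_lim; apply/funext => k /=; rewrite sumEFin.
Qed.

End integral_lemmas.

(* [omega beta] would be the junk value [x / 0 = 0] if the integral defining
   [Gamma] diverged.  Treating that case separately, where it is trivial, avoids
   proving that Gamma is finite and positive. *)
Lemma hcontent_omega0 (R : realType) n (beta : R) (E : set 'rV[R]_n) :
  0 < beta -> omega beta = 0 -> hcontent beta E = 0%E.
Proof.
move=> beta_gt0 w0; apply/eqP; rewrite eq_le hcontent_ge0 andbT.
apply: le_trans (@hcontent_le _ _ _ beta_gt0 _ (fun=> 0) (fun i => i%:R) _ _) _ => //.
- move=> y _; exists (Num.truncn (Num.sqrt (\sum_(i < n) (y ord0 i - (0 : 'rV[R]_n) ord0 i) ^+ 2))).+1 => //.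
  exact: truncnS_gt.
- by rewrite eseries0// => i _ _; rewrite w0 mul0r.
Qed.

(** * Weak and strong type bounds for the maximal function *)

Section maximal_function.
Context (R : realType) (n : nat) (beta : R).
Hypothesis beta_gt0 : 0 < beta.
Hypothesis w0 : 0 < omega beta.
Context (D : set 'rV[R]_n) (f : 'rV[R]_n -> R).
Local Notation H := (@hcontent R n beta).
Local Notation mu := (@lebesgue_measure R).
Local Notation Mf := (maximal beta D f).
Local Open Scope ereal_scope.

Definition layer (s : R) : set 'rV[R]_n := [set x | D x /\ (s < `|f x|)%R].

Lemma layer_ni s t : (s <= t)%R -> layer t `<=` layer s.
Proof. by move=> st x [Dx tx]; split => //; exact: le_lt_trans st tx. Qed.

(** Off [A] the restricted function is 0, which exceeds no height t > 0, so its superlevel sets are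
    the layers cut by [A]. *)
Lemma choquet_onE A :
  choquet_on beta D A (fun y => `|f y|%:E) = tail beta layer 0 A.
Proof.
apply: eq_integral => t; rewrite inE /= in_itv/= andbT => t0; congr (hcontent _ _).
apply/seteqP; split => x; rewrite /layer /= patchE.
  case: ifPn => [/set_mem Ax|_] [Dx]; first by rewrite lte_fin.
  by rewrite lte_fin => /(lt_trans t0); rewrite ltxx.
by move=> [[Dx tx] Ax]; rewrite mem_set.
Qed.

Lemma choquetE : choquet beta D (fun y => `|f y|%:E) = tail beta layer 0 setT.
Proof. by apply: eq_integral => t _; rewrite setIT. Qed.

Lemma maximal_gt t x : t%:E < Mf x -> exists2 r : R, (0 < r)%R &
  (t * (omega beta * r `^ beta))%:E < tail beta layer 0 (eball x r).
Proof.
move=> /ereal_sup_gt[_ [r r0 <-]]; rewrite choquet_onE => tr; exists r => //.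
by rewrite EFinM muleC -lte_pdivlMl// mulr_gt0 ?powR_gt0.
Qed.

Lemma maximal_ge0 x : 0 <= Mf x.
Proof.
apply: ereal_sup_ge; exists ((omega beta * 1 `^ beta)^-1%:E *
    choquet_on beta D (eball x 1) (fun y => `|f y|%:E)); first by exists 1%R => /=.
by rewrite choquet_onE mule_ge0 ?tail_ge0// lee_fin invr_ge0 mulr_ge0 ?powR_ge0// ltW.
Qed.

Lemma weak_type t : (0 < t)%R ->
  H [set x | t%:E < Mf x] <= (weak_const n beta / t)%:E *
    choquet beta D (fun x => `|f x|%:E).
Proof.
move=> t0; rewrite choquetE.
apply: le_trans (tail_weak beta_gt0 layer_ni 0 w0 t0).
by apply: le_hcontent => x /maximal_gt.
Qed.

(** Each layer at height up to [a] has content at most that of the whole ball, so dropping these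
    heights costs at most a omega r^beta. *)
Lemma tail_cut a x r : (0 < a)%R -> (0 < r)%R ->
  tail beta layer 0 (eball x r) <=
  (a * (omega beta * r `^ beta))%:E + tail beta layer a (eball x r).
Proof.
move=> a0 r0; rewrite /tail.
have -> : `]0%R, +oo[%classic = `]0%R, a] `|` `]a, +oo[ :> set (measurableTypeR R).
  apply/seteqP; split => s; rewrite /= !in_itv/= !andbT.
    by move=> s0; case: (leP s a) => sa; [left; rewrite s0|right].
  by move=> [/andP[]//|]; exact: lt_trans.
rewrite ge0_integral_setU//=; last 3 first.
- by apply: (measurable_layers beta layer_ni); exact: measurableU.
- by move=> *; exact: hcontent_ge0.
- rewrite disj_set2E; apply/eqP; rewrite -subset0 => s [] /=.
  by rewrite !in_itv/= andbT => /andP[_ /le_lt_trans h] /h; rewrite ltxx.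
apply: leeD => //.
apply: (@le_trans _ _ (\int[mu]_(s in `]0%R, a]) cst (omega beta * r `^ beta)%:E s)).
  apply: ge0_le_integral => //.
  - by move=> *; exact: hcontent_ge0.
  - exact: (measurable_layers beta layer_ni).
  - move=> s _; apply: le_trans (hcontent_ball beta_gt0 x (ltW r0)).
    by apply: le_hcontent; exact: subIsetr.
rewrite integral_cst//= lebesgue_measure_itv/= lte_fin a0.
by rewrite -EFinB subr0 -EFinM mulrC.
Qed.

(** Cutting at t / 2 uses up half of t omega r^beta; the other half must come from the tail above t
    / 2, and [tail_weak] applies at that level. *)
Lemma maximal_tail t : (0 < t)%R ->
  H [set x | t%:E < Mf x] <=
  (weak_const n beta / (t / 2))%:E * tail beta layer (t / 2) setT.
Proof.
move=> t0; have t2 : (0 < t / 2)%R by rewrite divr_gt0.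
apply: le_trans (tail_weak beta_gt0 layer_ni (t / 2) w0 t2).
apply: le_hcontent => x /maximal_gt[r r0 xr]; exists r => //.
have := lt_le_trans xr (tail_cut x t2 r0).
by rewrite {1}(splitr t) mulrDl EFinD lteD2lE.
Qed.

Context (p : R).
Hypothesis p1 : (1 < p)%R.
Let p0 : (0 < p)%R. Proof. exact: lt_trans p1. Qed.
Let pV0 : (0 < p^-1)%R. Proof. by rewrite invr_gt0. Qed.

Definition player (u : R) : set 'rV[R]_n := [set x | D x /\ (u < `|f x| `^ p)%R].

Lemma player_ni s t : (s <= t)%R -> player t `<=` player s.
Proof. by move=> st x [Dx tx]; split => //; exact: le_lt_trans st tx. Qed.

Lemma layer_powR l u : (0 <= l)%R -> (0 <= u)%R ->
  layer (l * u `^ p^-1) `<=` player (l `^ p * u).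
Proof.
move=> l0 u0 x [Dx lu]; split => //.
have -> : (l `^ p * u = (l * u `^ p^-1) `^ p)%R.
  by rewrite powRM ?powR_ge0// -powRrM mulVf ?gt_eqF// powRr1.
by rewrite gt0_ltr_powR// nnegrE ?mulr_ge0 ?powR_ge0.
Qed.

Lemma maximal_powR u : (0 < u)%R ->
  [set x | u%:E < Mf x `^ p] `<=` [set x | (u `^ p^-1)%:E < Mf x].
Proof.
move=> u0 x /=; rewrite !ltNge; apply: contra => Mu.
have -> : u%:E = (u `^ p^-1)%:E `^ p.
  by rewrite poweR_EFin -powRrM mulVf ?gt_eqF// powRr1// ltW.
apply: gt0_ler_poweR => //; first exact: ltW.
  by rewrite in_itv/= maximal_ge0 leey.
by rewrite in_itv/= lee_fin powR_ge0 leey.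
Qed.

(** The ratio of the final geometric series; it is below 1 because p > 1. *)
Lemma pow2_1Bp : (0 <= 2 `^ (1 - p) < 1)%R.
Proof.
rewrite powR_ge0/= /powR pnatr_eq0/= -[ltRHS]expR0 ltr_expR.
by rewrite nmulr_rlt0 ?subr_lt0// ln_gt0// ltr1n.
Qed.

Definition strong_const : R := weak_const n beta * (2 `^ p / (1 - 2 `^ (1 - p))).

Lemma strong_const_gt0 : (0 < strong_const)%R.
Proof.
have /andP[_ z1] := pow2_1Bp.
by rewrite mulr_gt0 ?weak_const_gt0// divr_gt0 ?powR_gt0// subr_gt0.
Qed.

Lemma strong_type :
  choquet beta setT (fun x => Mf x `^ p) <=
  strong_const%:E * choquet beta D (fun x => (`|f x| `^ p)%:E).
Proof.
have wc0 : (0 <= weak_const n beta)%R by rewrite ltW// weak_const_gt0.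
have mg (l : R) : (0 <= l)%R ->
    measurable_fun (`]0%R, +oo[ : set (measurableTypeR R)) (fun u : R => H (player (l * u)%R)).
  move=> l0; apply: nonincreasing_emeasurable => // s t st.
  by apply: le_hcontent; apply: player_ni; rewrite ler_wpM2l.
(* The layer of [f] at height (2^k / 2) u^(1/p) is contained in the layer of |f|^p at height
   [lam k * u]. *)
pose lam k : R := ((2 ^+ k / 2) `^ p)%R.
have lam0 k : (0 < lam k)%R by rewrite powR_gt0// divr_gt0// exprn_gt0.
have key u : (0 < u)%R -> H [set x | u%:E < Mf x `^ p] <=
    \sum_(k <oo) (weak_const n beta * 2 ^+ k)%:E * H (player (lam k * u)).
  move=> u0; have t0 : (0 < u `^ p^-1)%R by rewrite powR_gt0.
  have t2 : (0 < u `^ p^-1 / 2)%R by rewrite divr_gt0.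
  apply: le_trans (le_hcontent _ (maximal_powR u0)) _.
  apply: le_trans (maximal_tail t0) _.
  have h_ni s t : (s <= t)%R -> H (layer t) <= H (layer s).
    by move=> st; apply: le_hcontent; exact: layer_ni.
  have := integral_dyadic t2 (fun s => hcontent_ge0 beta (layer s)) h_ni.
  rewrite (_ : \int[_]_(_ in _) _ = tail beta layer (u `^ p^-1 / 2) setT); last first.
    by apply: eq_integral => s _; rewrite setIT.
  move=> /(lee_wpmul2l (_ : 0 <= (weak_const n beta / (u `^ p^-1 / 2))%:E)).
  move=> /(_ _)/le_trans; apply; first by rewrite lee_fin divr_ge0// ltW.
  rewrite -nneseriesZl; last first.
    by move=> k _; rewrite mule_ge0 ?hcontent_ge0// lee_fin mulr_ge0 ?exprn_ge0// ltW.
  apply: lee_nneseries => k *.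
    apply: mule_ge0; first by rewrite lee_fin divr_ge0// ltW.
    by rewrite mule_ge0 ?hcontent_ge0// lee_fin mulr_ge0 ?exprn_ge0// ltW.
  rewrite muleA -EFinM.
  rewrite (_ : (weak_const n beta / _ * _ = weak_const n beta * 2 ^+ k)%R); last first.
    by field; rewrite gt_eqF.
  apply: lee_wpmul2l; first by rewrite lee_fin mulr_ge0 ?exprn_ge0.
  apply: le_hcontent; rewrite (_ : (_ / 2 * _ = 2 ^+ k / 2 * u `^ p^-1)%R); last by ring.
  by apply: layer_powR; rewrite ?(ltW u0)// divr_ge0 ?exprn_ge0.
have term0 k u : 0 <= (weak_const n beta * 2 ^+ k)%:E * H (player (lam k * u)).
  by rewrite mule_ge0 ?hcontent_ge0// lee_fin mulr_ge0 ?exprn_ge0.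
have mterm k : measurable_fun (`]0%R, +oo[ : set (measurableTypeR R))
    (fun u : R => (weak_const n beta * 2 ^+ k)%:E * H (player (lam k * u)%R)).
  by apply: measurable_funeM; apply: mg; exact: ltW.
apply: (@le_trans _ _ (\int[mu]_(u in `]0%R, +oo[)
    \sum_(k <oo) (weak_const n beta * 2 ^+ k)%:E * H (player (lam k * u)))).
  apply: ge0_le_integral => //.
  - by move=> *; exact: hcontent_ge0.
  - apply: nonincreasing_emeasurable => // s t st; apply: le_hcontent => x [_ tx].
    by split => //; apply: le_lt_trans tx; rewrite lee_fin.
  - exact: ge0_emeasurable_sum.
  - move=> u /=; rewrite in_itv/= andbT => u0; apply: le_trans (key _ u0).
    by apply: le_hcontent => x [].
rewrite integral_nneseries//.
set I := choquet beta D _.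
have IE : I = \int[mu]_(u in `]0%R, +oo[) H (player u) by [].
have I0 : 0 <= I by apply: integral_ge0 => *; exact: hcontent_ge0.
have [->|Ioo] := eqVneq I +oo; first by rewrite gt0_muley ?leey// lte_fin strong_const_gt0.
have Ifin : I \is a fin_num by rewrite ge0_fin_numE// ltey.
have z01 := pow2_1Bp.
(* The dilation by [lam k] contributes its inverse, and 2^k / [lam k] equals 2^p (2^(1-p))^k. *)
rewrite (@eq_eseriesr _ _ (fun k => (fine I)%:E *
    (weak_const n beta * 2 `^ p * (2 `^ (1 - p)) ^+ k)%:E)); last first.
  move=> k _; rewrite ge0_integralZl//; last 3 first.
  - by apply: mg; exact: ltW.
  - by move=> *; exact: hcontent_ge0.
  - by rewrite lee_fin mulr_ge0 ?exprn_ge0.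
  rewrite (@ge0_integral_dilation _ (lam k) (fun u => H (player u)))//; last 2 first.
  - by apply: nonincreasing_emeasurable => // s t st; apply: le_hcontent; exact: player_ni.
  - by move=> *; exact: hcontent_ge0.
  rewrite -IE fineK// muleA -EFinM muleC; congr (_ * _%:E).
  have -> : lam k = ((2 `^ p) ^+ k / 2 `^ p)%R.
    rewrite /lam powRM ?exprn_ge0 ?invr_ge0//; congr (_ * _)%R.
      by rewrite -[in LHS]powR_mulrn// powRAC powR_mulrn// powR_ge0.
    by rewrite -[in LHS]powR_inv1// powRAC powR_inv1// powR_ge0.
  rewrite powRB ?pnatr_eq0 ?implybT// powRr1// exprMn exprVn.
  by field; rewrite ?expf_neq0 ?gt_eqF ?powR_gt0.
rewrite nneseriesZl; last first.
  by move=> k _; rewrite lee_fin !mulr_ge0 ?exprn_ge0 ?powR_ge0.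
rewrite geometric_nneseries//; last by rewrite mulr_ge0 ?powR_ge0.
by rewrite fineK// muleC /strong_const mulrA.
Qed.

End maximal_function.

Theorem theorem1p2 (R : realType) (n : nat) (beta p : R)
  (beta_gt0 : 0 < beta) (beta_ltn : beta < n%:R) (p_ge1 : 1 <= p) :
  (1 < p ->
    exists2 C : R, 0 < C &
      forall (D : set 'rV[R]_n) (f : 'rV[R]_n -> R),
        in_Lp beta p D f ->
        (choquet beta setT (fun x => maximal beta D f x `^ p)
           <= C%:E * choquet beta D (fun x => (`|f x| `^ p)%:E))%E)
  /\
  (p = 1 ->
    exists2 C : R, 0 < C &
      forall (D : set 'rV[R]_n) (f : 'rV[R]_n -> R),
        in_Lp beta 1 D f ->
        forall t : R, 0 < t ->
          (hcontent beta [set x | t%:E < maximal beta D f x]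
             <= (C / t)%:E * choquet beta D (fun x => `|f x|%:E))%E).
Proof.
have := omega_ge0 beta; rewrite le_eqVlt => /predU1P[/esym w0|w0].
  have choquet0 D (g : 'rV[R]_n -> \bar R) : choquet beta D g = 0%E.
    by rewrite /choquet integral0_eq// => t _; exact: hcontent_omega0.
  split=> _; exists 1 => // D f _; first by rewrite !choquet0 mule0.
  by move=> t _; rewrite hcontent_omega0// choquet0 mule0.
split=> [p1|_].
  exists (strong_const n beta p); first exact: strong_const_gt0.
  by move=> D f _; exact: strong_type.
exists (weak_const n beta); first exact: weak_const_gt0.
by move=> D f _ t t0; exact: weak_type.
Qed.
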